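(* Let $0<a<\frac12$ and, for $m > \max \left\{ \frac{6}{a}, \frac{2}{1-2a} \right\}$, let $$\hat{\psi}_m(\gamma) = \hat{\varphi}_m \left(\gamma + \tfrac{3a}{4}\right) + \hat{\varphi}_m\left(\gamma - \tfrac{3a}{4}\right).$$ Then there does not exist an integrable function $g: \widehat{\mathbb{R}} \to \mathbb{R}$ such that $$\hat{\psi}_m = \mathbbm{1}_{[-a,-\frac a2]\cup[\frac a2,a]} \ast g_{(m)}\quad\text{for all } m > \max \left\{ \tfrac{6}{a}, \tfrac{2}{1-2a} \right\},$$ where $g_{(m)}(\gamma) = m\,g(m\gamma)$.
   Context: Let $f:\mathbb{R}\to\mathbb{R}$ be $f(\gamma)=e^{-1/\gamma}$ for $\gamma>0$ and $f(\gamma)=0$ for $\gamma\le0$. For $b,m>0$ with $b-\frac1m>0$ define $$\hat{\varphi}_{b,m}(\gamma)=\frac{f\left(b+\frac1m-|\gamma|\right)}{f\left(b+\frac1m-|\gamma|\right)+f\left(|\gamma|-b+\frac1m\right)}.$$ For $a>\frac4m$ write $\hat{\varphi}_m=\hat{\varphi}_{\frac a4,m}$. $\widehat{\mathbb{R}}$ denotes $\mathbb{R}$ as frequency domain, $\mathbbm{1}_S$ is the characteristic function of $S$, and $\ast$ is convolution. *)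

(* Defs.v *)
(* MathComp-Analysis. *)
From HB Require Import structures.
From mathcomp Require Import all_boot all_order all_algebra.
From mathcomp Require Import all_classical all_reals all_analysis.

Set Implicit Arguments.
Unset Strict Implicit.
Unset Printing Implicit Defensive.

Import Order.TTheory GRing.Theory Num.Theory.
Import numFieldNormedType.Exports.

Local Open Scope classical_set_scope.
Local Open Scope ring_scope.

Definition expinv {R : realType} (x : R) : R :=
  if 0 < x then expR (- (1 / x)) else 0.

Definition phihat_bm {R : realType} (b m x : R) : R :=
  expinv (b + 1 / m - `|x|) /
  (expinv (b + 1 / m - `|x|) + expinv (`|x| - b + 1 / m)).

Definition phihat {R : realType} (a m : R) : R -> R := phihat_bm (a / 4) m.

Definition psihat {R : realType} (a m : R) : R -> R :=
  fun x => phihat a m (x + 3 * a / 4) + phihat a m (x - 3 * a / 4).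

(* Integrability and convolution are taken with respect to the completed
   measure, so that they concern Lebesgue (not only Borel) measurable
   functions. *)
Definition lebesgue_integrable {R : realType} (g : R -> R) : Prop :=
  (@completed_lebesgue_measure R).-integrable setT (EFin \o g).

Definition convolution {R : realType} (f g : R -> R) : R -> R :=
  fun x => \int[@completed_lebesgue_measure R]_t (f (x - t : R) * g t).

Definition dilation {R : realType} (m : R) (g : R -> R) : R -> R :=
  fun x => m * g (m * x).

(* Main.v *)
Require Import Defs.
From HB Require Import structures.
From mathcomp Require Import all_boot all_order all_algebra.
From mathcomp Require Import all_classical all_reals all_analysis.
From mathcomp Require Import measurable_realfun ring lra.

Set Implicit Arguments.
Unset Strict Implicit.
Unset Printing Implicit Defensive.

Import Order.TTheory GRing.Theory Num.Theory.
Import numFieldNormedType.Exports.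

Local Open Scope classical_set_scope.
Local Open Scope ring_scope.

(** The transition profile of the bump is not scale invariant. At the outer edge,
    with [s] in [[0, 1)], the value of [psihat a m] at [a - s / m] is
    [p / (p + q)] with [p = exp (- m / (1 + s))] and [q = exp (- m / (1 - s))]
    ([psihat_right_edge]). It is therefore [1 / 2] at [a] itself, but already at
    least [3 / 4] at [a - 1 / m ^ 2], because there [ln (p / q) >= 2].

    On the other side, the substitution [y = m t] turns the convolution at [x]
    into the integral of [g] over the set of all [y] such that [x - y / m] lies
    in the two bands ([convolution_indic_dilation]). For [x = a - e_m / m] with
    [e_m] in [[0, 1]] tending to [0], these sets converge pointwise to the half
    line [0 <= y] ([near_mem_edge]), so by dominated convergence
    ([cvg_Rintegral_indic]) the convolution tends to the integral [L] of [g] over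
    that half line, whatever the sequence [e]. Taking [e_m = 0] gives
    [L <= 1 / 2], and taking [e_m = 1 / m] gives [L >= 3 / 4].

    The substitution takes place on Lebesgue measurable sets, so the scaling law
    is first shown for the Lebesgue outer measure, by scaling the covers; it
    follows that dilations preserve Caratheodory measurability. *)

(** The Lebesgue outer measure on the line. *)
Local Notation outer := ((@wlength _ idfun)^*%mu).

Lemma preimage_scale_itvoc {R : realType} (c u v : R) : 0 < c ->
  ( *%R c) @^-1` `]u, v] = `]c^-1 * u, c^-1 * v]%classic.
Proof.
move=> c0; apply/seteqP; split=> x /=; rewrite !in_itv/=;
  by rewrite ltr_pdivrMl// ler_pdivlMl.
Qed.

Lemma wlength_preimage_scale {R : realType} (c : R) (A : set R) : 0 < c -> ocitv A ->
  ocitv ( *%R c @^-1` A) /\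
  wlength idfun ( *%R c @^-1` A) = (c^-1%:E * wlength idfun A)%E.
Proof.
move=> c0 [[u v] _ <-] /=; rewrite preimage_scale_itvoc//.
split; first exact: is_ocitv.
have W x y : @wlength R idfun `]x, y]%classic =
    (if x < y then y - x else 0)%:E.
  by rewrite wlength_itv/= lte_fin; case: ifP.
rewrite !W ltr_pM2l ?invr_gt0//.
by case: ifP => _; rewrite -EFinM ?mulr0// mulrBr.
Qed.

Lemma outer_scale_le {R : realType} (c : R) (A : set R) : 0 < c ->
  (outer ( *%R c @^-1` A) <= c^-1%:E * outer A)%E.
Proof.
move=> c0; rewrite lee_pdivlMl//.
apply: le_ereal_inf_tmp => _ [F [mF AF] <-].
rewrite -lee_pdivlMl//.
rewrite -nneseriesZl; last by move=> i _; exact: wlength_ge0.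
apply: ereal_inf_lbound; exists (fun k => *%R c @^-1` F k).
  split=> [i|]; first exact: (wlength_preimage_scale c0 (mF i)).1.
  by move=> x /= /AF [k _ Fk]; exists k.
by apply: eq_eseriesr => k _; exact: (wlength_preimage_scale c0 (mF k)).2.
Qed.

Lemma outer_scale {R : realType} (c : R) (A : set R) : 0 < c ->
  outer ( *%R c @^-1` A) = (c^-1%:E * outer A)%E.
Proof.
move=> c0; apply/eqP; rewrite eq_le outer_scale_le//=.
have ci0 : 0 < c^-1 by rewrite invr_gt0.
(* the reverse inequality is the same bound for the inverse dilation *)
have := outer_scale_le ( *%R c @^-1` A) ci0.
have -> : *%R c^-1 @^-1` ( *%R c @^-1` A) = A.
  by rewrite -comp_preimage; apply/seteqP; split=> x /=; rewrite mulVKf ?gt_eqF.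
by rewrite invrK lee_pdivrMl.
Qed.

(** Both sides of the Caratheodory criterion for the preimage of a set, tested on
    a set written as the preimage of [Y], are [c^-1] times those of the original
    set tested on [Y]. *)
Lemma measurable_scale {R : realType} (c : R) : 0 < c ->
  measurable_fun setT
    ( *%R c : caratheodory_type (@wlength R idfun)^*%mu ->
              caratheodory_type (@wlength R idfun)^*%mu).
Proof.
move=> c0 _ A mA; rewrite setTI.
have cA X : outer X = (outer (X `&` A) + outer (X `&` ~` A))%E by exact: mA.
suff cB X : outer X = (outer (X `&` *%R c @^-1` A) +
    outer (X `&` ~` ( *%R c @^-1` A)))%E by exact: cB.
have [Y ->] : exists Y, X = *%R c @^-1` Y.
  exists ( *%R c^-1 @^-1` X).
  by rewrite -comp_preimage; apply/seteqP; split=> x /=; rewrite mulKf ?gt_eqF.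
have sc (B : set R) : outer ( *%R c @^-1` B) = (c^-1%:E * outer B)%E.
  exact: outer_scale.
have ge0 (B : set R) : (0 <= outer B :> \bar R)%E.
  by apply: mu_ext_ge0 => X'; exact: wlength_ge0.
rewrite preimage_setC.
rewrite -(preimage_setI ( *%R c) Y A) -(preimage_setI ( *%R c) Y (~` A)).
rewrite sc sc sc (cA Y).
exact: ge0_muleDr.
Qed.

(** Change of variables along a map [phi] that divides the measure of preimages
    by [c]. *)
Section scaling_map.
Context d (T : measurableType d) (R : realType).
Variables (mu : {measure set T -> \bar R}) (phi : T -> T) (c : R).
Hypotheses (c0 : 0 < c) (mphi : measurable_fun setT phi).
Hypothesis mu_phi : forall A, measurable A ->
  mu (phi @^-1` A) = (c^-1%:E * mu A)%E.

Let ge0_integral_scaling_map (f : T -> \bar R) :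
  measurable_fun setT f -> (forall x, 0 <= f x)%E ->
  (\int[mu]_t (c%:E * f (phi t)) = \int[mu]_t f t)%E.
Proof.
move=> mf f0; have ci0 : 0 <= c^-1 by rewrite invr_ge0 ltW.
rewrite ge0_integralZl//; last 2 first.
- exact: (measurableT_comp mf).
- by rewrite lee_fin ltW.
rewrite -[X in (_ * X)%E](@ge0_integral_pushforward _ _ T T _ _ mphi mu setT f)//.
rewrite (eq_measure_integral (mscale (NngNum ci0) mu) (m1 := pushforward mu phi)).
  by rewrite ge0_integral_mscale//= muleA -EFinM divff ?mul1e// gt_eqF.
by move=> A mA _; exact: mu_phi.
Qed.

Lemma Rintegral_scaling_map (f : T -> R) : measurable_fun setT f ->
  \int[mu]_t (c * f (phi t)) = \int[mu]_t f t.
Proof.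
move=> mf; rewrite /Rintegral; congr fine.
have mF : measurable_fun setT (EFin \o f) by exact/measurable_EFinP.
have cp : (fun t => (c * f (phi t))%:E) =
    (fun t => c%:E * (EFin \o f \o phi) t)%E.
  by apply/funext => t; rewrite EFinM.
rewrite [LHS]integralE [RHS]integralE cp.
rewrite ge0_funeposM ?ge0_funenegM ?ltW//.
congr (_ - _)%E.
- rewrite funepos_comp.
  exact: (ge0_integral_scaling_map (measurable_funepos mF) (funepos_ge0 _)).
- rewrite funeneg_comp.
  exact: (ge0_integral_scaling_map (measurable_funeneg mF) (funeneg_ge0 _)).
Qed.

End scaling_map.

(** Dominated convergence over domains that converge pointwise. The set [A]
    need not be assumed measurable: the integrand [\1_A t * g t] is measurable as a
    pointwise limit. *)
Lemma cvg_Rintegral_indic d (T : measurableType d) (R : realType)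
    (mu : {measure set T -> \bar R}) (A_ : (set T)^nat) (A : set T) (g : T -> R) :
  (forall n, measurable (A_ n)) ->
  mu.-integrable setT (EFin \o g) ->
  (forall x, \forall n \near \oo, A_ n x <-> A x) ->
  \int[mu]_t (\1_(A_ n) t * g t) @[n --> \oo] --> \int[mu]_t (\1_A t * g t).
Proof.
move=> mA ig AA.
have mg : measurable_fun setT g by exact/measurable_EFinP/(measurable_int mu).
have m1 n : measurable_fun setT (EFin \o (fun t => \1_(A_ n) t * g t)).
  by apply/measurable_EFinP/measurable_funM.
have cvA x : (EFin \o (fun t => \1_(A_ n) t * g t)) x @[n --> \oo] -->
    (\1_A x * g x)%:E.
  apply: cvg_near_cst; near=> n => /=.
  have An : A_ n x <-> A x by near: n; exact: AA.
  suff -> : \1_(A_ n) x = \1_A x :> R by [].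
  by rewrite !indicE; congr (_%:R); congr nat_of_bool;
    apply/idP/idP => /set_mem/An/mem_set.
have mf : measurable_fun setT (EFin \o (fun t => \1_A t * g t)).
  apply: (@emeasurable_fun_cvg _ _ _ _ _ _ m1) => x _; exact: cvA.
have [|||if_ _ cv] := @dominated_convergence _ T R mu setT measurableT
   (fun n => EFin \o (fun t => \1_(A_ n) t * g t)) (EFin \o (fun t => \1_A t * g t))
   (abse \o (EFin \o g)) m1 mf.
- by apply: aeW => x _; exact: cvA.
- exact: integrable_abse.
- apply: aeW => x n _ /=; rewrite lee_fin normrM ler_piMl//.
  by rewrite indicE; case: (_ \in _); rewrite ?normr1 ?normr0.
- apply: fine_cvg; rewrite fineK; first exact: cv.
  exact: (integrable_fin_num measurableT if_).
Unshelve. all: by end_near. Qed.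

(** Near [a] only the bump centred at [3 a / 4] contributes. *)
Lemma psihat_right_edge {R : realType} (a m s : R) : 0 < a -> 6 / a < m ->
  0 <= s < 1 ->
  psihat a m (a - s / m) = expR (- (m / (1 + s))) /
    (expR (- (m / (1 + s))) + expR (- (m / (1 - s)))).
Proof.
move=> a0 am /andP[s0 s1].
have m0 : 0 < m by apply: le_lt_trans am; rewrite divr_ge0// ltW.
have ma : m^-1 < a / 6 by rewrite -[ltRHS]invf_div ltf_pV2// posrE divr_gt0.
have mi : 0 < m^-1 by rewrite invr_gt0.
have sm : 0 <= s / m < m^-1.
  by rewrite divr_ge0 ?(ltW m0)//= ltr_pdivrMr// mulVf// gt_eqF.
set u := m^-1 in ma mi sm *.
have sE : s / m = s * u by [].
rewrite /psihat /phihat /phihat_bm !div1r -/u.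
rewrite (@ger0_norm _ (a - s / m + 3 * a / 4)); last lra.
rewrite (@ger0_norm _ (a - s / m - 3 * a / 4)); last lra.
rewrite {1}/expinv ifF ?mul0r ?add0r; last by apply/negbTE; rewrite -leNgt; lra.
have E1 : a / 4 + u - (a - s / m - 3 * a / 4) = (1 + s) / m by rewrite /u; lra.
have E2 : a - s / m - 3 * a / 4 - a / 4 + u = (1 - s) / m by rewrite /u; lra.
rewrite E1 E2 /expinv !divr_gt0//; try lra.
by rewrite !div1r !invf_div.
Qed.

Lemma psihat_at_edge {R : realType} (a m : R) : 0 < a -> 6 / a < m ->
  psihat a m a = 1 / 2.
Proof.
move=> a0 am; have := @psihat_right_edge _ a m 0 a0 am.
rewrite lexx ltr01 mul0r !subr0 addr0 => ->//.
have := expR_gt0 (- (m / 1)); set e := expR _ => e0.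
by field; apply/lt0r_neq0; lra.
Qed.

(** Here [q - p = 2 m ^ 2 / (m ^ 2 - 1) >= 2], hence the ratio of the two
    exponentials is at least [exp 2 >= 3]. *)
Lemma psihat_inside_edge {R : realType} (a m : R) : 0 < a -> 6 / a < m -> 1 < m ->
  3 / 4 <= psihat a m (a - m^-1 / m).
Proof.
move=> a0 am m1; rewrite psihat_right_edge//; last first.
  by rewrite invr_ge0 invf_lt1 ?m1 ?andbT; lra.
set p := m / (1 + _); set q := m / (1 - _).
have pq : 2 <= q - p.
  have -> : q - p = 2 * m ^+ 2 / (m ^+ 2 - 1).
    by rewrite /q /p; field; rewrite !gt_eqF//; nra.
  by rewrite ler_pdivlMr; nra.
have e3 : 3 * expR (- q) <= expR (- p).
  have -> : - p = (q - p) + - q by ring.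
  rewrite expRD ler_pM2r ?expR_gt0//.
  by apply: le_trans (expR_ge1Dx _); lra.
have := expR_gt0 (- p); have := expR_gt0 (- q) => q0 p0.
by rewrite ler_pdivlMr; lra.
Qed.

(** For [y >= 0] the shifted point is at most [a] and tends to [a]; for [y < 0] it
    is eventually to the right of [a]. The index [n] stands for the
    dilation factor [n + 1]. *)
Lemma near_mem_edge {R : realType} (a : R) (e : R^nat) (y : R) :
  0 < a -> (forall n, 0 <= e n <= 1) -> e n @[n --> \oo] --> 0 ->
  \forall n \near \oo,
    (`[- a, - (a / 2)] `|` `[a / 2, a])%classic
      (a - e n / n.+1%:R - n.+1%:R^-1 * y) <-> 0 <= y.
Proof.
move=> a0 e01 e_cvg.
have [y0|y0] := leP 0 y.
  near=> n.
  have m0 : 0 < n.+1%:R :> R by [].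
  (* from this rank on the shift is at most [a / 2], the width of a band *)
  have mb : 2 * (1 + y) / a <= n%:R by near: n; exact: nbhs_infty_ger.
  have /andP[en0 en1] := e01 n.
  have d : e n / n.+1%:R + n.+1%:R^-1 * y = (e n + y) / n.+1%:R
    by rewrite [_^-1 * y]mulrC -mulrDl.
  have d0 : 0 <= (e n + y) / n.+1%:R by rewrite divr_ge0// addr_ge0.
  have d1 : (e n + y) / n.+1%:R <= a / 2.
    rewrite ler_pdivrMr// -(natr1 n).
    by move: mb; rewrite ler_pdivrMr// => mb; lra.
  split=> // _; right; rewrite /= in_itv/= -addrA -opprD d.
  by move: d0 d1; set Q := (_ / _) => d0 d1; apply/andP; split; lra.
near=> n.
have m0 : 0 < n.+1%:R :> R by [].
have ey : e n < - y by near: n; apply: (cvgr_lt 0) => //; rewrite oppr_gt0.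
have d : e n / n.+1%:R + n.+1%:R^-1 * y = (e n + y) / n.+1%:R
  by rewrite [_^-1 * y]mulrC -mulrDl.
have d0 : (e n + y) / n.+1%:R < 0 by rewrite ltr_pdivrMr// mul0r; lra.
split=> // -[] /=; rewrite in_itv/= -addrA -opprD d.
  by move: d0; set Q := (_ / _) => d0 /andP[_ xa]; lra.
by move: d0; set Q := (_ / _) => d0 /andP[_ xa]; lra.
Unshelve. all: by end_near. Qed.

(** Borel sets pulled back along affine maps are Lebesgue measurable. *)
Lemma measurable_affine_preimage {R : realType} (S : set R) (x c : R) :
  measurable S ->
  (@wlength R idfun)^*%mu.-cara.-measurable [set y : R | S (x - c * y)].
Proof.
move=> mS; apply: (@sub_caratheodory _ (ocitv_type R) R (wlength idfun)).
have mF : measurable_fun setT (fun y : R => x - c * y).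
  by apply: measurable_funB => //; exact: measurable_funM.
by rewrite -[X in _ X]setTI; exact: mF.
Qed.

Lemma convolution_indic_dilation {R : realType} (S : set R) (g : R -> R) (m x : R) :
  measurable S -> lebesgue_integrable g -> 0 < m ->
  convolution (\1_S) (dilation m g) x =
  \int[@completed_lebesgue_measure R]_y
    (\1_([set y : R | S (x - m^-1 * y)]) y * g y).
Proof.
move=> mS ig m0.
have mA := measurable_affine_preimage x m^-1 mS.
have mg := measurable_int _ ig.
rewrite -(Rintegral_scaling_map m0 (measurable_scale m0)).
- rewrite /convolution /dilation; apply: eq_Rintegral => t _.
  by rewrite !indicE mulrCA; congr (_ * (_%:R * _)); congr nat_of_bool;
    apply/idP/idP; rewrite !inE/= mulKf ?gt_eqF.
- by move=> A _; exact: outer_scale.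
- by apply: measurable_funM => //; exact/measurable_EFinP.
Qed.

Theorem corollary24 (R : realType) (a : R) (a_gt0 : 0 < a) (a_lt : a < 1 / 2) :
  ~ exists g : R -> R, lebesgue_integrable g /\
      forall m : R, Num.max (6 / a) (2 / (1 - 2 * a)) < m ->
        psihat a m =
        convolution (\1_(`[- a, - (a / 2)] `|` `[a / 2, a])) (dilation m g).
Proof.
move=> [g [ig conv]].
pose S : set R := `[- a, - (a / 2)] `|` `[a / 2, a].
have mS : measurable S by apply: measurableU; exact: measurable_itv.
have large (M : R) : \forall n \near \oo, M < n.+1%:R.
  near=> n; apply: (@lt_trans _ _ n%:R); last by rewrite ltr_nat.
  by near: n; exact: nbhs_infty_gtr.
pose L := \int[@completed_lebesgue_measure R]_y (\1_([set y : R | 0 <= y]) y * g y).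
have lim_conv (e : R^nat) : (forall n, 0 <= e n <= 1) ->
    e n @[n --> \oo] --> 0 ->
    psihat a n.+1%:R (a - e n / n.+1%:R) @[n --> \oo] --> L.
  move=> e01 e0.
  have cv := @cvg_Rintegral_indic _ _ R (@completed_lebesgue_measure R)
    (fun n => [set y : R | S (a - e n / n.+1%:R - n.+1%:R^-1 * y)])
    [set y : R | 0 <= y] g (fun n => measurable_affine_preimage _ _ mS) ig
    (fun y => near_mem_edge y a_gt0 e01 e0).
  apply: cvg_trans cv; apply: near_eq_cvg; near=> n.
  rewrite conv; last by near: n; exact: large.
  by rewrite convolution_indic_dilation.
have L_le : L <= 1 / 2.
  have cv0 : psihat a n.+1%:R (a - 0 / n.+1%:R) @[n --> \oo] --> L.
    by apply: (lim_conv (fun=> 0)) => [_|]; [rewrite lexx ler01|exact: cvg_cst].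
  apply: (cvgr_to_le cv0); near=> n.
  by rewrite mul0r subr0 psihat_at_edge//; near: n; exact: large.
have L_ge : 3 / 4 <= L.
  have harm01 n : 0 <= (harmonic n : R) <= 1.
    by rewrite /harmonic invr_ge0 ler0n invf_le1// ler1n.
  apply: (cvgr_to_ge (lim_conv harmonic harm01 cvg_harmonic)); near=> n.
  by apply: psihat_inside_edge => //; near: n; exact: large.
by lra.
Unshelve. all: by end_near. Qed.
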